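(* Let $m\ge2$ be even, $\kappa>0$, $\mathcal{P}=\{\kappa(2k-1-m):k=1,\dots,m\}\subset\mathbb{R}$, and let $\mathcal{A}=\{a+jb:a,b\in\mathcal{P}\}$ be the corresponding rectangular QAM constellation. Then the differential un-combined MDC-QOSTBC with four transmit antennas and information symbols drawn from $\mathcal{A}$ achieves diversity order $2$ (half diversity): the minimum of $\operatorname{rank}\big(\mathbf{V}'(x)-\mathbf{V}'(\tilde x)\big)$ over all pairs of distinct $x,\tilde x\in\mathcal{A}^4$ (and all previous-block amplitudes) equals $2$, where $\mathbf{V}'$ is the actual information matrix defined in the context.
   Context: For $x\in\mathbb{C}$ write $x=x^R+jx^I$ with $x^R,x^I\in\mathbb{R}$, $j=\sqrt{-1}$; $^*$ is complex conjugation. Scheme. Given $x_1,\dots,x_4\in\mathcal{A}$ put $c_1=x_1^R+jx_3^R$, $c_2=x_2^R+jx_4^R$, $c_3=-x_1^I+jx_3^I$, $c_4=-x_2^I+jx_4^I$. With normalization $p=2$, the information matrices of the two equivalent $2\times2$ subsystems are $\frac{1}{\sqrt p}\begin{pmatrix} c_1 & c_2 \\ -c_2^* & c_1^* \end{pmatrix}$ and $\frac{1}{\sqrt p}\begin{pmatrix} c_3 & c_4 \\ -c_4^* & c_3^* \end{pmatrix}$. Each subsystem is differentially encoded by multiplying its previous transmit matrix on the left by its new information matrix divided by the amplitude of its previous block; the amplitudes are $a_1=\big(\frac1p\sum_{i=1}^4(y_i^R)^2\big)^{1/2}>0$ and $a_2=\big(\frac1p\sum_{i=1}^4(y_i^I)^2\big)^{1/2}>0$,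 where $y_1,\dots,y_4\in\mathcal{A}$ are the information symbols of the previous block. The subsystem transmit matrices are $\mathbf{A}+\mathbf{B}$ and $\mathbf{A}-\mathbf{B}$, where $\begin{pmatrix} \mathbf{A} & \mathbf{B} \\ \mathbf{B} & \mathbf{A} \end{pmatrix}$ is the actual $4\times4$ transmit matrix. Actual information matrix. The $4\times4$ matrix by which the previous actual transmit matrix is left-multiplied to obtain the new one is $$\mathbf{V}'(x_1,\dots,x_4)=\begin{pmatrix} v_1' & v_2' & v_3' & v_4' \\ -v_2'^* & v_1'^* & -v_4'^* & v_3'^* \\ {} v_3' & v_4' & v_1' & v_2' \\ -v_4'^* & v_3'^* & -v_2'^* & v_1'^* \end{pmatrix},$$ with $v_1'=\frac{1}{2\sqrt p}\big(\frac{c_1}{a_1}+\frac{c_3}{a_2}\big)$, $v_2'=\frac{1}{2\sqrt p}\big(\frac{c_2}{a_1}+\frac{c_4}{a_2}\big)$, $v_3'=\frac{1}{2\sqrt p}\big(\frac{c_1}{a_1}-\frac{c_3}{a_2}\big)$, $v_4'=\frac{1}{2\sqrt p}\big(\frac{c_2}{a_1}-\frac{c_4}{a_2}\big)$. In the difference $\mathbf{V}'(x)-\mathbf{V}'(\tilde x)$ both matrices use the same $a_1,a_2$. The diversity order (one receive antenna) is the minimum rank of $\mathbf{V}'(x)-\mathbf{V}'(\tilde x)$ over distinct $x,\tilde x\in\mathcal{A}^4$. *)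

(* Defs.v *)
From HB Require Import structures.
From mathcomp Require Import all_boot all_order all_algebra.
From mathcomp Require Import reals ring.
From mathcomp Require Export complex.

Set Implicit Arguments.
Unset Strict Implicit.
Unset Printing Implicit Defensive.

Import Order.TTheory GRing.Theory Num.Theory.

(* In this order, _^* is the conjugation Num.conj of ring_scope. *)
Local Open Scope complex_scope.
Local Open Scope ring_scope.

Definition pam (R : realType) (m : nat) (kappa : R) : seq R :=
  [seq kappa * ((2 * k)%:R - 1 - m%:R) | k <- iota 1 m].

Definition qam (R : realType) (m : nat) (kappa : R) : seq R[i] :=
  [seq a +i* b | a <- pam m kappa, b <- pam m kappa].

(* Symbols are indexed from 0: x_k is x`_(k-1), for k = 1, ..., 4. *)
Section Scheme.
Variable R : realType.
Implicit Types x y : 4.-tuple R[i].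

Definition c1 x : R[i] := complex.Re x`_0 +i* complex.Re x`_2.
Definition c2 x : R[i] := complex.Re x`_1 +i* complex.Re x`_3.
Definition c3 x : R[i] := (- complex.Im x`_0) +i* complex.Im x`_2.
Definition c4 x : R[i] := (- complex.Im x`_1) +i* complex.Im x`_3.

(* The normalization p = 2. *)
Definition pnorm : R := 2.

Definition amp1 y : R :=
  Num.sqrt (pnorm^-1 * \sum_(i < 4) complex.Re y`_i ^+ 2).
Definition amp2 y : R :=
  Num.sqrt (pnorm^-1 * \sum_(i < 4) complex.Im y`_i ^+ 2).

Definition mx_of_rows (n : nat) (rows : seq (seq R[i])) : 'M[R[i]]_n :=
  \matrix_(i < n, j < n) (nth [::] rows i)`_j.

Definition info_sub (c d : R[i]) : 'M[R[i]]_2 :=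
  ((Num.sqrt pnorm)^-1)%:C *: mx_of_rows 2
    [:: [:: c; d];
        [:: - d^*; c^*]].

Definition info_sub1 x := info_sub (c1 x) (c2 x).
Definition info_sub2 x := info_sub (c3 x) (c4 x).

Definition half_norm : R[i] := ((2 * Num.sqrt pnorm)^-1)%:C.

(* In v1', ..., v4' and V', x is the new block and y the previous one, which
   enters only through its amplitudes. *)
Definition v1' y x : R[i] :=
  half_norm * (c1 x / (amp1 y)%:C + c3 x / (amp2 y)%:C).
Definition v2' y x : R[i] :=
  half_norm * (c2 x / (amp1 y)%:C + c4 x / (amp2 y)%:C).
Definition v3' y x : R[i] :=
  half_norm * (c1 x / (amp1 y)%:C - c3 x / (amp2 y)%:C).
Definition v4' y x : R[i] :=
  half_norm * (c2 x / (amp1 y)%:C - c4 x / (amp2 y)%:C).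

Definition V' y x : 'M[R[i]]_4 :=
  let v1 := v1' y x in let v2 := v2' y x in
  let v3 := v3' y x in let v4 := v4' y x in
  mx_of_rows 4
    [:: [:: v1;      v2;    v3;      v4];
        [:: - v2^*; v1^*; - v4^*; v3^*];
        [:: v3;      v4;    v1;      v2];
        [:: - v4^*; v3^*; - v2^*; v1^*]].

Definition diff_rank y x x' : nat := \rank (V' y x - V' y x').

(* The minimum of the rank over distinct x, x' in A^4 and over previous blocks
   y in A^4 exists and equals d. *)
Definition has_diversity_order (A : seq R[i]) (d : nat) : Prop :=
  (exists y x x' : 4.-tuple R[i],
     [/\ {subset y <= A}, {subset x <= A}, {subset x' <= A},
         x <> x' & diff_rank y x x' = d]) /\
  (forall y x x' : 4.-tuple R[i],
     {subset y <= A} -> {subset x <= A} -> {subset x' <= A} ->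
     x <> x' -> (d <= diff_rank y x x')%N).

Definition transmit_mx (A B : 'M[R[i]]_2) : 'M[R[i]]_(2 + 2) :=
  block_mx A B B A.

Lemma V'_block y x :
  let U1 := ((amp1 y)%:C)^-1 *: info_sub1 x in
  let U2 := ((amp2 y)%:C)^-1 *: info_sub2 x in
  V' y x = transmit_mx (2^-1 *: (U1 + U2)) (2^-1 *: (U1 - U2)).
Proof.
rewrite /V' /v1' /v2' /v3' /v4' /info_sub1 /info_sub2 /info_sub /transmit_mx.
move: (c1 x) (c2 x) (c3 x) (c4 x) => d1 d2 d3 d4 /=.
have conjR (a : R) : (a%:C)^* = a%:C.
  by rewrite -[LHS]/(a +i* (- 0)) oppr0.
have hE : half_norm = 2^-1 * ((Num.sqrt pnorm)^-1)%:C.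
  by rewrite /half_norm invfM rmorphM fmorphV rmorph_nat.
rewrite -!fmorphV /=.
have hJ : half_norm^* = half_norm by exact: conjR.
move: half_norm hJ hE => h hJ hE.
move: (_^-1)%:C (conjR (amp1 y)^-1) => b1 b1J.
move: (_^-1)%:C (conjR (amp2 y)^-1) => b2 b2J.
move: (((Num.sqrt pnorm)^-1)%:C : R[i]) hE => s hE.
apply/(@matrixP _ (2 + 2) (2 + 2)) => i j.
case: (@split_ordP 2 2 i) => {}i ->; case: (@split_ordP 2 2 j) => {}j ->;
rewrite ?block_mxEul ?block_mxEur ?block_mxEdl ?block_mxEdr
  [mx_of_rows 4 _ _ _]mxE !mxE;
case: i => [[|[|//]] hi]; case: j => [[|[|//]] hj];
rewrite /= ?(rmorphM, rmorphD, rmorphB, rmorphN) /= ?hJ ?b1J ?b2J hE; ring.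
Qed.

(* V' is the matrix that updates the actual transmit matrix when each subsystem
   is encoded differentially with its own amplitude. *)
Lemma V'_transmit y x (A B A' B' : 'M[R[i]]_2) :
  A' + B' = ((amp1 y)%:C)^-1 *: info_sub1 x *m (A + B) ->
  A' - B' = ((amp2 y)%:C)^-1 *: info_sub2 x *m (A - B) ->
  transmit_mx A' B' = (V' y x : 'M_(2 + 2)) *m transmit_mx A B.
Proof.
rewrite V'_block; move: (_ *: info_sub1 x) (_ *: info_sub2 x) => U1 U2 hp hm.
have half (M : 'M[R[i]]_2) : 2^-1 *: (M + M) = M.
  by rewrite -mulr2n -[M *+ 2]scaler_nat scalerA mulVf ?scale1r // pnatr_eq0.
have A'E : 2^-1 *: (U1 *m (A + B) + U2 *m (A - B)) = A'.
  by rewrite -hp -hm addrACA subrr addr0 half.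
have B'E : 2^-1 *: (U1 *m (A + B) - U2 *m (A - B)) = B'.
  by rewrite -hp -hm opprB addrC addrA addrNK half.
rewrite /transmit_mx (mulmx_block (_ *: (U1 + U2))).
have E1 : 2^-1 *: (U1 + U2) *m A + 2^-1 *: (U1 - U2) *m B = A'.
  rewrite -A'E -!scalemxAl -scalerDr !(mulmxDl, mulmxDr, mulmxN, mulNmx).
  by rewrite addrACA.
have E2 : 2^-1 *: (U1 + U2) *m B + 2^-1 *: (U1 - U2) *m A = B'.
  rewrite -B'E -!scalemxAl -scalerDr !(mulmxDl, mulmxDr, mulmxN, mulNmx).
  congr (_ *: _).
  by rewrite opprB [LHS]addrC [LHS]addrACA [- _ + _]addrC.
have E3 : 2^-1 *: (U1 - U2) *m A + 2^-1 *: (U1 + U2) *m B = B'.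
  by rewrite addrC.
have E4 : 2^-1 *: (U1 - U2) *m B + 2^-1 *: (U1 + U2) *m A = A'.
  by rewrite addrC.
by rewrite E1 E2 E3 E4.
Qed.
End Scheme.

(* Main.v *)
Require Import Defs.
From mathcomp Require Import all_boot all_order all_algebra.
From mathcomp Require Import reals.

(** Writing [U1], [U2] for the subsystem information matrices divided by the
    amplitudes (nonzero because, [m] being even, [0] is not a PAM value), [V']
    is the block matrix with diagonal blocks [(U1 + U2) / 2] and off-diagonal
    blocks [(U1 - U2) / 2]. Thus [(I I) V' (I I)^T = 2 U1] and
    [(I -I) V' (I -I)^T = 2 U2]. A nonzero difference of Alamouti matrices is
    invertible, which gives rank at least 2. If the two blocks differ only in
    the real part of one symbol, then the second subsystem does not see the
    difference, all four blocks coincide and the rank is at most 2. *)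

Import Order.TTheory GRing.Theory Num.Theory.

Local Open Scope complex_scope.
Local Open Scope ring_scope.

(** A zero value would mean [2 * k = m + 1], an even number equal to an odd one. *)
Lemma pam_neq0 (R : realType) (m : nat) (kappa a : R) :
  ~~ odd m -> 0 < kappa -> a \in pam m kappa -> a != 0.
Proof.
move=> hm hk /mapP[k _ ->]; rewrite mulf_neq0 ?(lt0r_neq0 hk) //.
rewrite -addrA -opprD [1 + _]addrC natr1 subr_eq0 eqr_nat.
by apply/eqP => /(congr1 odd); rewrite /= oddM /= (negbTE hm).
Qed.

Lemma mem_qam (R : realType) (m : nat) (kappa : R) (z : R[i]) :
  (z \in qam m kappa) =
    (complex.Re z \in pam m kappa) && (complex.Im z \in pam m kappa).
Proof.
case: z => a b; apply/allpairsP/andP => /= [[[c d] /= [hc hd [-> ->]]]|[ha hb]].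
  by [].
by exists (a, b).
Qed.

(** One positive square among nonnegative ones suffices. Keeping [f] abstract serves both
    amplitudes, with real and with imaginary parts. *)
Lemma amp_sum_neq0 (R : realType) (f : 'I_4 -> R) :
  f ord0 != 0 -> Num.sqrt ((pnorm R)^-1 * \sum_(i < 4) f i ^+ 2) != 0.
Proof.
move=> f0; rewrite gt_eqF // sqrtr_gt0 mulr_gt0 ?invr_gt0 ?ltr0n //.
rewrite big_ord_recl ltr_pwDl ?exprn_even_gt0 //.
by apply: sumr_ge0 => i _; apply: sqr_ge0.
Qed.

Section Rank.
Variable R : realType.
Implicit Types (c d : R[i]) (x y : 4.-tuple R[i]).

Lemma info_subB c d c' d' :
  info_sub c d - info_sub c' d' = info_sub (c - c') (d - d').
Proof.
rewrite /info_sub -scalerBr; congr (_ *: _); apply/matrixP => i j; rewrite !mxE.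
by case: i => [[|[|//]] hi]; case: j => [[|[|//]] hj];
  rewrite /= ?rmorphB ?opprB //= opprK addrC.
Qed.

(** The determinant is a nonzero multiple of [|c|^2 + |d|^2]. *)
Lemma rank_info_sub c d : (c != 0) || (d != 0) -> \rank (info_sub c d) = 2.
Proof.
move=> cd0; apply: mxrank_unit; rewrite unitmxE detZ (expand_det_row _ 0).
rewrite !big_ord_recl big_ord0 /cofactor !det_mx11 !mxE /= unitfE.
rewrite mulf_neq0 ?expf_neq0 //.
  by rewrite fmorph_eq0 invr_eq0 gt_eqF // sqrtr_gt0 ltr0n.
(* The sign of the second cofactor cancels the minus of the entry [- d^*], so both terms become
   squared moduli. *)
rewrite -[(0 + bump 0 0)%N]/1%N expr0 expr1 mul1r mulN1r opprK addr0 -!normCK 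
  paddr_eq0 ?exprn_ge0 // !expf_eq0 /= !normr_eq0.
by rewrite negb_and.
Qed.

Lemma transmit_mx_sub (A B A' B' : 'M[R[i]]_2) :
  transmit_mx A B - transmit_mx A' B' = transmit_mx (A - A') (B - B').
Proof. by rewrite /transmit_mx opp_block_mx add_block_mx. Qed.

Lemma transmit_mx_halfB (A B A' B' : 'M[R[i]]_2) :
  transmit_mx (2^-1 *: (A + B)) (2^-1 *: (A - B)) -
    transmit_mx (2^-1 *: (A' + B')) (2^-1 *: (A' - B')) =
  transmit_mx (2^-1 *: (A - A' + (B - B'))) (2^-1 *: (A - A' - (B - B'))).
Proof.
rewrite transmit_mx_sub -!scalerBr !opprD.
by rewrite [A + B + _]addrACA [A - B + _]addrACA.
Qed.

(** Both matrices share the amplitudes of [y], so the block form passes to differences by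
    linearity. *)
Lemma V'B_block y x x' (U1 := info_sub1 x - info_sub1 x')
    (U2 := info_sub2 x - info_sub2 x')
    (W1 := ((amp1 y)%:C)^-1 *: U1) (W2 := ((amp2 y)%:C)^-1 *: U2) :
  V' y x - V' y x' =
    transmit_mx (2^-1 *: (W1 + W2)) (2^-1 *: (W1 - W2)).
Proof.
rewrite /W1 /W2 /U1 /U2 {W1 W2 U1 U2}.
have := V'_block y x; have := V'_block y x'; cbv zeta.
move: (V' y x) (V' y x') => M M'.
move: (info_sub1 x) (info_sub1 x') (info_sub2 x) (info_sub2 x').
move=> A A' B B' -> ->.
by rewrite (scalerBr _ A) (scalerBr _ B); apply: transmit_mx_halfB.
Qed.

Lemma transmit_mxD (A B : 'M[R[i]]_2) :
  row_mx 1%:M 1%:M *m transmit_mx A B *m col_mx 1%:M 1%:M = 2 *: (A + B).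
Proof.
rewrite mul_row_block mul_row_col !mul1mx !mulmx1 [B + A]addrC.
by rewrite scaler_nat mulr2n.
Qed.

Lemma transmit_mxB (A B : 'M[R[i]]_2) :
  row_mx 1%:M (- 1%:M) *m transmit_mx A B *m col_mx 1%:M (- 1%:M) =
    2 *: (A - B).
Proof.
rewrite mul_row_block mul_row_col !mulNmx !mulmxN !mul1mx !mulmx1 opprB.
by rewrite scaler_nat mulr2n.
Qed.

Lemma rank_transmitD (A B : 'M[R[i]]_2) :
  (\rank (A + B)%R <= \rank (transmit_mx A B))%N.
Proof.
rewrite -(mxrank_scale_nz (A + B) (a := 2)) ?pnatr_eq0 // -transmit_mxD.
exact: leq_trans (mxrankM_maxl _ _) (mxrankM_maxr _ _).
Qed.

Lemma rank_transmitB (A B : 'M[R[i]]_2) :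
  (\rank (A - B)%R <= \rank (transmit_mx A B))%N.
Proof.
rewrite -(mxrank_scale_nz (A - B) (a := 2)) ?pnatr_eq0 // -transmit_mxB.
exact: leq_trans (mxrankM_maxl _ _) (mxrankM_maxr _ _).
Qed.

Lemma rank_transmit_diag (A : 'M[R[i]]_2) : (\rank (transmit_mx A A) <= 2)%N.
Proof.
(* The matrix factors through a space of dimension 2. *)
have -> : transmit_mx A A = col_mx A A *m row_mx 1%:M 1%:M.
  by rewrite mul_col_row !mulmx1.
exact: leq_trans (mxrankM_maxl _ _) (rank_leq_col _).
Qed.

Lemma half_addB (W1 W2 : 'M[R[i]]_2) :
  2^-1 *: (W1 + W2) + 2^-1 *: (W1 - W2) = W1.
Proof.
by rewrite -scalerDr addrACA subrr addr0 -mulr2n -[W1 *+ 2]scaler_nat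
  scalerA mulVf ?scale1r ?pnatr_eq0.
Qed.

Lemma half_subB (W1 W2 : 'M[R[i]]_2) :
  2^-1 *: (W1 + W2) - 2^-1 *: (W1 - W2) = W2.
Proof.
by rewrite -scalerBr opprB addrC addrA subrK -mulr2n -[W2 *+ 2]scaler_nat
  scalerA mulVf ?scale1r ?pnatr_eq0.
Qed.

Lemma diff_rank_ge1 y x x' : amp1 y != 0 ->
  (\rank (info_sub1 x - info_sub1 x')%R <= diff_rank y x x')%N.
Proof.
move=> a0; rewrite /diff_rank V'B_block; apply: leq_trans (rank_transmitD _ _).
by rewrite half_addB mxrank_scale_nz ?invr_eq0 ?fmorph_eq0.
Qed.

Lemma diff_rank_ge2 y x x' : amp2 y != 0 ->
  (\rank (info_sub2 x - info_sub2 x')%R <= diff_rank y x x')%N.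
Proof.
move=> a0; rewrite /diff_rank V'B_block; apply: leq_trans (rank_transmitB _ _).
by rewrite half_subB mxrank_scale_nz ?invr_eq0 ?fmorph_eq0.
Qed.

Lemma diff_rank_le2 y x x' :
  info_sub2 x = info_sub2 x' -> (diff_rank y x x' <= 2)%N.
Proof.
move=> e; rewrite /diff_rank V'B_block e subrr scaler0 addr0 subr0.
exact: rank_transmit_diag.
Qed.

(** The four combinations carry, up to sign, all eight real coordinates of the block. *)
Lemma eq_cs x x' : c1 x = c1 x' -> c2 x = c2 x' -> c3 x = c3 x' ->
  c4 x = c4 x' -> x = x'.
Proof.
move=> [r0 r2] [r1 r3] [/oppr_inj i0 i2] [/oppr_inj i1 i3].
apply: eq_from_tnth => i; rewrite !(tnth_nth 0).
by case: i => [[|[|[|[|//]]]] hi] /=; apply/eqP; rewrite eq_complex;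
  apply/andP; split; apply/eqP.
Qed.

Lemma diff_rank_ge_two y x x' : amp1 y != 0 -> amp2 y != 0 -> x <> x' ->
  (2 <= diff_rank y x x')%N.
Proof.
move=> a1 a2 xx'.
(* Distinct blocks are told apart by at least one subsystem; if not by the first, then by the
   second. *)
have [n1|] := boolP ((c1 x - c1 x' != 0) || (c2 x - c2 x' != 0)).
  apply: leq_trans (diff_rank_ge1 y x x' a1).
  by rewrite info_subB rank_info_sub.
rewrite negb_or !negbK !subr_eq0 => /andP[/eqP e1 /eqP e2].
apply: leq_trans (diff_rank_ge2 y x x' a2).
rewrite info_subB rank_info_sub // !subr_eq0 -negb_and; apply/andP => -[].
by move=> /eqP e3 /eqP e4; apply: xx'; apply: eq_cs.
Qed.

End Rank.

Lemma amp_qam_neq0 (R : realType) (m : nat) (kappa : R) (y : 4.-tuple R[i]) :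
  ~~ odd m -> 0 < kappa -> {subset y <= qam m kappa} ->
  amp1 y != 0 /\ amp2 y != 0.
Proof.
move=> hm hk /(_ y`_0); rewrite mem_nth ?size_tuple // mem_qam.
move=> /(_ isT)/andP[r0 i0]; split.
- exact: (amp_sum_neq0 _ (fun i => complex.Re y`_i)
    (pam_neq0 _ _ _ _ hm hk r0)).
- exact: (amp_sum_neq0 _ (fun i => complex.Im y`_i)
    (pam_neq0 _ _ _ _ hm hk i0)).
Qed.

Theorem mainTheorem6 (R : realType) (m : nat) (kappa : R)
  (hm2 : (2 <= m)%N) (hm : ~~ odd m) (hkappa : 0 < kappa) :
  has_diversity_order (qam m kappa) 2.
Proof.
have lower y x x' : {subset y <= qam m kappa} -> x <> x' ->
    (2 <= diff_rank y x x')%N.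
  by move=> /(amp_qam_neq0 _ _ _ _ hm hkappa)[a1 a2]; apply: diff_rank_ge_two.
split=> [|y x x' yA _ _]; last exact: lower.
pose p k : R := kappa * ((2 * k)%:R - 1 - m%:R).
have pP k : (0 < k <= m)%N -> p k \in pam m kappa.
  by move=> hk; apply: map_f; rewrite mem_iota.
have p1 : p 1%N \in pam m kappa by apply: pP; rewrite (ltnW hm2).
have p2 : p 2%N \in pam m kappa by apply: pP.
have p12 : p 2%N <> p 1%N.
  by move/(mulfI (lt0r_neq0 hkappa))/addIr/addIr/eqP; rewrite eqr_nat.
(* These symbols differ only in their real parts, which [c3] and [c4] ignore; [2 <= m] provides the
   two PAM values. *)
pose a := p 1%N +i* p 1%N; pose b := p 2%N +i* p 1%N.
have aA : a \in qam m kappa by rewrite mem_qam p1.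
have bA : b \in qam m kappa by rewrite mem_qam p1 p2.
pose x : 4.-tuple R[i] := [tuple b; a; a; a].
pose x' : 4.-tuple R[i] := [tuple a; a; a; a].
have x'A : {subset x' <= qam m kappa}.
  by apply/allP; rewrite /= aA.
have xA : {subset x <= qam m kappa}.
  by apply/allP; rewrite /= aA bA.
have xx' : x <> x' by case.
(* Any block over the constellation can serve as the previous one; [x'] is reused. *)
exists x', x, x'; split=> //; apply/eqP; rewrite eqn_leq lower // andbT.
(* The second information matrices of [x] and [x'] agree by computation. *)
exact: diff_rank_le2.
Qed.
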